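(* Let $\mathcal H$ be a real Hilbert space, let $m$ be a strictly positive integer, and let $(\omega_i)_{1\leq i\leq m}\in\,]0,1]^m$ satisfy $\sum_{i=1}^m\omega_i=1$. For every $i\in\{0,\ldots,m\}$, let $T_i\colon\mathcal H\to\mathcal H$ be $\alpha_i$-averaged for some $\alpha_i\in\,]0,1[$. A point of $\operatorname{Fix}\big(T_0\circ\sum_{i=1}^m\omega_iT_i\big)$ is called a solution. Let $K$ be a strictly positive integer and let $(I_n)_{n\in\mathbb N}$ be a sequence of nonempty subsets of $\{1,\ldots,m\}$ such that $\bigcup_{k=0}^{K-1}I_{n+k}=\{1,\ldots,m\}$ for every $n\in\mathbb N$. For every integer $n\geq K-1$ and every $i\in\{1,\ldots,m\}$, set $$\ell_i(n)=\max\{k\in\{n-K+1,\ldots,n\}\mid i\in I_k\}.$$ Let $(e_{0,n})_{n\in\mathbb N},(e_{1,n})_{n\in\mathbb N},\ldots,(e_{m,n})_{n\in\mathbb N}$ be sequences in $\mathcal H$ such that $$\sum_{n\geq K-1}\|e_{0,n}\|<+\infty\quad\text{and}\quad(\forall i\in\{1,\ldots,m\})\ \sum_{n\geq K-1}\|e_{i,\ell_i(n)}\|<+\infty.$$ Let $\varepsilon\in\,]0,1[$ and, for every $n\in\mathbb N$ and every $i\in\{0\}\cup I_n$, let $\alpha_{i,n}\in\,]0,1/(1+\varepsilon)[$ and let $T_{i,n}\colon\mathcal H\to\mathcal H$ be $\alpha_{i,n}$-averaged. Suppose that, for every integer $n\geq K-1$, $$\varnothing\neq\operatorname{Fix}\Big(T_0\circ\sum_{i=1}^m\omega_iT_i\Big)\subset\operatorname{Fix}\Big(T_{0,n}\circ\sum_{i=1}^m\omega_iT_{i,\ell_i(n)}\Big).$$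 Let $x_0\in\mathcal H$, let $(t_{i,-1})_{1\leq i\leq m}\in\mathcal H^m$, and define iteratively, for $n=0,1,\ldots$, $$t_{i,n}=\begin{cases}T_{i,n}x_n+e_{i,n},&\text{if } i\in I_n;\\ t_{i,n-1},&\text{if } i\in\{1,\ldots,m\}\smallsetminus I_n,\end{cases}\qquad x_{n+1}=T_{0,n}\Big(\sum_{i=1}^m\omega_it_{i,n}\Big)+e_{0,n}.$$ Let $x$ be a solution. Then the following hold (limits as $n\to+\infty$ are in norm unless stated otherwise): (i) $(x_n)_{n\in\mathbb N}$ is bounded. (ii) Let $i\in\{1,\ldots,m\}$. Then $x_{\ell_i(n)}-T_{i,\ell_i(n)}x_{\ell_i(n)}+T_{i,\ell_i(n)}x-x\to 0$. (iii) Let $i,j\in\{1,\ldots,m\}$. Then $T_{i,\ell_i(n)}x_{\ell_i(n)}-T_{j,\ell_j(n)}x_{\ell_j(n)}-T_{i,\ell_i(n)}x+T_{j,\ell_j(n)}x\to 0$. (iv) Let $i\in\{1,\ldots,m\}$. Then $x_{\ell_i(n)}-x_n\to 0$. (v) $x_n-T_{0,n}\big(\sum_{i=1}^m\omega_iT_{i,\ell_i(n)}x_n\big)\to 0$. (vi) Suppose that every weak sequential cluster point of $(x_n)_{n\in\mathbb N}$ is a solution. Then: (a) $(x_n)_{n\in\mathbb N}$ converges weakly to a solution; (b) if, in addition, $(x_n)_{n\in\mathbb N}$ has a strong sequential cluster point, then $(x_n)_{n\in\mathbb N}$ converges strongly to a solution. (vii) Let $\rho_0,\ldots,\rho_m\in\,]0,1]$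 be such that, for every integer $n\geq K-1$ and every $i\in\{0\}\cup I_n$, $\rho_i$ is a Lipschitz constant of $T_{i,n}$. Suppose that the iteration is implemented without errors (all $e_{i,n}=0$) and that $\rho_i<1$ for some $i\in\{0,\ldots,m\}$. Then $(x_n)_{n\in\mathbb N}$ converges linearly to the unique solution.
   Context: An operator $T\colon\mathcal H\to\mathcal H$ is nonexpansive if it is $1$-Lipschitzian; it is $\alpha$-averaged, for $\alpha\in\,]0,1[$, if $\operatorname{Id}+\alpha^{-1}(T-\operatorname{Id})$ is nonexpansive. $\operatorname{Fix}T$ is the set of fixed points of $T$. Linear convergence of $(x_n)_{n\in\mathbb N}$ to $x$ means that there exist $c\geq 0$ and $r\in\,]0,1[$ such that $\|x_n-x\|\leq c\,r^n$ for every $n\in\mathbb N$. A weak (resp. strong) sequential cluster point of a sequence is the weak (resp. norm) limit of one of its subsequences. *)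

(* Defs.v *)
From HB Require Import structures.
From mathcomp Require Import all_boot all_order all_algebra.
From mathcomp Require Import all_classical all_reals all_analysis.

Set Implicit Arguments.
Unset Strict Implicit.
Unset Printing Implicit Defensive.

Import Order.TTheory GRing.Theory Num.Theory.
Import numFieldNormedType.Exports.

Local Open Scope classical_set_scope.
Local Open Scope ring_scope.

HB.mixin Record CompleteNormedModule_isHilbert (R : realType) H
    of CompleteNormedModule R H := {
  dot : H -> H -> R ;
  dotC : forall u v : H, dot u v = dot v u ;
  dotDl : forall u v w : H, dot (u + v) w = dot u w + dot v w ;
  dotZl : forall (a : R) (u v : H), dot (a *: u) v = a * dot u v ;
  dot_norm : forall u : H, dot u u = `|u| ^+ 2
}.

#[short(type="hilbertType")]
HB.structure Definition Hilbert (R : realType) :=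
  {H of CompleteNormedModule_isHilbert R H & CompleteNormedModule R H}.

Section Operators.
Context {R : realType} {H : hilbertType R}.

Definition nonexpansive (T : H -> H) : Prop := 1.-lipschitz T.

(* The condition 0 < alpha < 1 is not built in: it is assumed separately. *)
Definition averaged (alpha : R) (T : H -> H) : Prop :=
  nonexpansive (fun u => u + alpha^-1 *: (T u - u)).

Definition Fix (T : H -> H) : set H := [set u | T u = u].

Definition wsum m (omega : 'I_m -> R) (T : 'I_m -> H -> H) : H -> H :=
  fun u => \sum_(i < m) omega i *: T i u.

Definition weak_cvg (u_ : nat -> H) (u : H) : Prop :=
  forall v : H, dot (u_ n) v @[n --> \oo] --> dot u v.

Definition weak_seq_cluster (u_ : nat -> H) (u : H) : Prop :=
  exists2 k : nat -> nat, increasing_seq k & weak_cvg (u_ \o k) u.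

Definition strong_seq_cluster (u_ : nat -> H) (u : H) : Prop :=
  exists2 k : nat -> nat, increasing_seq k & u_ (k n) @[n --> \oo] --> u.

Definition linear_cvg (u_ : nat -> H) (u : H) : Prop :=
  exists c r : R, [/\ 0 <= c, 0 < r < 1 & forall n, `|u_ n - u| <= c * r ^+ n].

End Operators.

(* The maximum is taken over n - K + 1 <= k <= n. When n < K - 1 the
   truncated subtraction makes the range {0, ..., n}, and the maximum of an
   empty family is 0: the value is only meaningful for n >= K - 1. *)
Definition ell m (I : nat -> {set 'I_m}) (K : nat) (i : 'I_m) (n : nat) : nat :=
  (\max_(n.+1 - K <= k < n.+1 | i \in I k) k)%N.

(* Main.v *)
(* Fix a solution y and put a_n = |x_n - y|.  Nonexpansiveness bounds a_{n+1}
   by the weighted mean of the a_{l_i(n)} plus a summable error; since I_n is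
   nonempty, a fixed positive weight sits on a_n itself, and this forces a_n to
   converge to some L.  The intermediate norms |T_{0,n} u - y|, |u - v| and
   |sum_i w_i z_i|, where u = sum_i w_i t_{i,n}, v = sum_i w_i T_{i,l_i(n)} y
   and z_i = T_{i,l_i(n)} x_{l_i(n)} - T_{i,l_i(n)} y, are then squeezed to the
   same L, so all the quadratic gaps (averagedness of the operators, variance
   of the z_i) vanish; this gives (ii)-(v).  For (vi) one concludes by Opial's
   argument, and (vii) is a contraction over a window of length K. *)

Require Import Defs.
From mathcomp Require Import all_boot all_order all_algebra.
From mathcomp Require Import all_classical all_reals all_analysis.
From mathcomp Require Import ring lra zify.

Set Implicit Arguments.
Unset Strict Implicit.
Unset Printing Implicit Defensive.

Import Order.TTheory GRing.Theory Num.Theory.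
Import numFieldNormedType.Exports.

Local Open Scope classical_set_scope.
Local Open Scope ring_scope.

(** * Inner products and averaged operators *)

Section Dot.
Context {R : realType} {H : hilbertType R}.
Implicit Types (u v w : H) (a : R).

Lemma dotDr u v w : dot u (v + w) = dot u v + dot u w.
Proof. by rewrite dotC dotDl !(dotC u). Qed.

Lemma dotZr a u v : dot u (a *: v) = a * dot u v.
Proof. by rewrite dotC dotZl dotC. Qed.

Lemma dotNl u v : dot (- u) v = - dot u v.
Proof. by rewrite -scaleN1r dotZl mulN1r. Qed.

Lemma dotNr u v : dot u (- v) = - dot u v.
Proof. by rewrite dotC dotNl dotC. Qed.

Lemma dot0l u : dot 0 u = 0.
Proof. by rewrite -(scale0r 0) dotZl mul0r. Qed.

Lemma dot0r u : dot u 0 = 0.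
Proof. by rewrite dotC dot0l. Qed.

Definition dotE := (@dotDl R H, dotDr, dotNl, dotNr, @dotZl R H, dotZr).

Lemma dot_sumr (J : finType) u (f : J -> H) :
  dot u (\sum_j f j) = \sum_j dot u (f j).
Proof.
by apply: (big_morph (dot u)) => [v w|]; [exact: dotDr|exact: dot0r].
Qed.

(** Cauchy-Schwarz: expand the square norm of [|v|^2 u - (dot u v) v], which is [|v|^2] times the
    difference of the two squared sides. *)
Lemma norm_dot_le u v : `|dot u v| <= `|u| * `|v|.
Proof.
have [->|v0] := eqVneq v 0; first by rewrite dot0r !normr0 mulr0.
have nv : 0 < `|v| by rewrite normr_gt0.
rewrite -(@ler_pXn2r _ 2%N) ?nnegrE ?mulr_ge0// exprMn real_normK ?num_real//.
have : 0 <= `|(`|v| ^+ 2) *: u - dot u v *: v| ^+ 2 by exact: sqr_ge0.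
rewrite -dot_norm !dotE !dot_norm (dotC v u).
set d := dot u v; set p := `|v|; set q := `|u|.
rewrite (_ : _ + _ = p ^+ 2 * (q ^+ 2 * p ^+ 2 - d ^+ 2)); last by ring.
by rewrite pmulr_rge0 ?exprn_gt0// subr_ge0.
Qed.

(** The quadratic inequality of an averaged operator, with its constant [(1 - alpha) / alpha]
    replaced by a lower bound [eps] that is uniform in [n]. *)
Definition firm (eps : R) (T : H -> H) : Prop := forall u v,
  `|T u - T v| ^+ 2 + eps * `|(u - T u) - (v - T v)| ^+ 2 <= `|u - v| ^+ 2.

(** With [d = u - v] and [w] the difference of the residuals, averagedness squares to
    [alpha^-1 |w|^2 <= 2 dot d w]. As [1 + eps <= alpha^-1], this bounds the cross term of
    [|d - w|^2]. *)
Lemma averaged_firm alpha (T : H -> H) eps : 0 < eps ->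
  0 < alpha < 1 / (1 + eps) -> averaged alpha T ->
  firm eps T.
Proof.
move=> e0 /andP[a0 aeps] Tavg u v; move: Tavg => /(_ (u, v) (conj I I)) /=; rewrite mul1r.
set d := u - v; set w := (u - T u) - (v - T v).
have -> : u + alpha^-1 *: (T u - u) - (v + alpha^-1 *: (T v - v)) =
    d - alpha^-1 *: w.
  by rewrite opprD addrACA -scalerBr -(opprB u (T u)) -(opprB v (T v)) -opprD
             scalerN.
have -> : T u - T v = d - w.
  by rewrite /w opprD addrACA -opprD !subKr.
clearbody d w.
rewrite -(@ler_pXn2r _ 2%N) ?nnegrE// -!dot_norm !dotE !dot_norm (dotC w d).
set dw := dot d w; set p := `|w| ^+ 2; set q := `|d| ^+ 2 => h.
have p0 : 0 <= p by exact: sqr_ge0.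
have ia : 1 + eps <= alpha^-1.
  by rewrite -[1 + eps]invrK lef_pV2 ?posrE ?invr_gt0 ?addr_gt0// ltW// -div1r.
have {}h : alpha^-1 * p <= 2 * dw.
  rewrite -(@ler_pM2l _ alpha^-1) ?invr_gt0//; nra.
have : (1 + eps) * p <= alpha^-1 * p by rewrite ler_wpM2r.
nra.
Qed.

(** The left-hand side is a weighted variance: once both terms on the right share a limit, every
    [z j] with positive weight merges with the mean. *)
Lemma variance (J : finType) (omega : J -> R) (z : J -> H) :
  \sum_j omega j = 1 -> let c := \sum_j omega j *: z j in
  \sum_j omega j * `|z j - c| ^+ 2 =
  \sum_j omega j * `|z j| ^+ 2 - `|c| ^+ 2.
Proof.
move=> s1 c.
have -> : \sum_j omega j * `|z j - c| ^+ 2 =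
  \sum_j (omega j * `|z j| ^+ 2 - 2 * dot c (omega j *: z j)
          + omega j * `|c| ^+ 2).
  apply: eq_bigr => j _; rewrite -!dot_norm !dotE (dotC (z j) c); ring.
rewrite big_split sumrB/= -mulr_sumr -dot_sumr -mulr_suml s1 dot_norm; ring.
Qed.

Lemma convex_norm (J : finType) (omega : J -> R) (z : J -> H) :
  (forall j, 0 <= omega j) ->
  `|\sum_j omega j *: z j| <= \sum_j omega j * `|z j|.
Proof.
move=> o0; apply: (le_trans (ler_norm_sum _ _ _)).
by apply: ler_sum => j _; rewrite normrZ ger0_norm.
Qed.

End Dot.

(** * Recursions over a window of past terms *)

Section RealSequences.
Context {R : realType}.

Lemma cvg0_sqr (V : normedModType R) (f : nat -> V) (g : nat -> R) c : 0 < c ->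
  (\forall n \near \oo, c * `|f n| ^+ 2 <= g n) ->
  g n @[n --> \oo] --> 0 -> f n @[n --> \oo] --> (0 : V).
Proof.
move=> c0 fg g0; apply/cvgr0Pnorm_lt => e e0.
have ce : 0 < c * e ^+ 2 by rewrite mulr_gt0// exprn_gt0.
move/cvgr0Pnorm_lt : g0 => /(_ _ ce) g0; near=> n.
rewrite -(@ltr_pXn2r _ 2%N) ?nnegrE ?(ltW e0)//.
rewrite -(ltr_pM2l c0); apply: (@le_lt_trans _ _ (g n)); first by near: n.
by apply: (le_lt_trans (ler_norm _)); near: n.
Unshelve. all: by end_near. Qed.

Lemma cvg_sqr (T : Type) (F : set_system T) {FF : Filter F} (u : T -> R) (l : R) :
  u n @[n --> F] --> l -> u n ^+ 2 @[n --> F] --> l ^+ 2.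
Proof. by move=> ul; exact: (cvg_comp _ _ ul (@exprn_continuous R 2%N l)). Qed.

Lemma cvg0_le (V : normedModType R) (f : nat -> V) (g : nat -> R) :
  (\forall n \near \oo, `|f n| <= g n) ->
  g n @[n --> \oo] --> 0 -> f n @[n --> \oo] --> (0 : V).
Proof.
move=> fg g0; apply/norm_cvg0P.
apply: (squeeze_cvgr _ (cvg_cst 0) g0).
by apply: filterS fg => n; rewrite normr_ge0.
Qed.

Lemma cvg0_sub (f g : nat -> R) (l : R) :
  f n @[n --> \oo] --> l -> g n @[n --> \oo] --> l ->
  f n - g n @[n --> \oo] --> 0.
Proof. by move=> fl gl; rewrite -(subrr l); exact: cvgB. Qed.

Lemma cvg_sumr (J : finType) (g : J -> nat -> R) (l : J -> R) :
  (forall j, g j n @[n --> \oo] --> l j) ->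
  \sum_j g j n @[n --> \oo] --> \sum_j l j.
Proof. by move=> gl; apply: cvg_big => [|j _]; [exact: add_continuous|exact: gl]. Qed.

Lemma cvg0_sum (J : finType) (g : J -> nat -> R) :
  (forall j, g j n @[n --> \oo] --> 0) ->
  \sum_j g j n @[n --> \oo] --> 0.
Proof. by move=> /cvg_sumr; rewrite big1. Qed.

(** The search for the next index starts at [(k N).+1], which gives strict increase. The dependence
    of [P] on [N] allows diagonal extractions. *)
Lemma subseq_choice (P : nat -> nat -> Prop) :
  (forall N n, exists2 k, (n <= k)%N & P N k) ->
  exists2 k : nat -> nat, increasing_seq k & forall N, P N (k N).
Proof.
move=> exP; have /choice[g gP] : forall Nn : nat * nat,
    exists k, (Nn.2 <= k)%N /\ P Nn.1 k.
  by move=> [N n]; have [k] := exP N n; exists k.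
pose k := fix k N := if N is N'.+1 then g (N, (k N').+1) else g (0%N, 0%N).
exists k; last by case=> [|N]; [exact: (gP (0%N, 0%N)).2|exact: (gP (N.+1, (k N).+1)).2].
by apply/increasing_seqP => N; rewrite ltEnat; exact: (gP (N.+1, (k N).+1)).1.
Qed.

Lemma cvgn_increasing (k : nat -> nat) : increasing_seq k ->
  k n @[n --> \oo] --> \oo.
Proof.
move=> /increasing_seqP kS; apply/cvgnyPge => A; near=> n.
have nk : forall j, (j <= k j)%N.
  by elim=> // j jk; exact: leq_ltn_trans jk (kS j).
by apply: leq_trans (nk n); near: n; exists A.
Unshelve. all: by end_near. Qed.

Section WindowRecursion.
Context (eps : nat -> R) (eps0 : forall n, 0 <= eps n).

Lemma bounded_sums_tail C N0 : (forall n, \sum_(N0 <= k < n) eps k <= C) ->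
  forall zeta, 0 < zeta ->
  exists2 N, (N0 <= N)%N & forall n, \sum_(N <= k < n) eps k <= zeta.
Proof.
move=> epsC zeta zeta0.
pose E := [set \sum_(N0 <= k < n) eps k | n in [set: nat]].
have supE : has_sup E.
  split; first by exists (\sum_(N0 <= k < 0) eps k), 0%N.
  by exists C => _ [n _ <-].
have [_ [N _ <-] sN] := sup_adherent zeta0 supE.
(* The nearly optimal [N] may fall below [N0], where its partial sum is empty. *)
exists (maxn N0 N) => [|n]; first exact: leq_maxl.
have [nN|Nn] := leqP n (maxn N0 N); first by rewrite big_geq// ltW.
have : \sum_(N0 <= k < n) eps k <= sup E.
  by apply: (ub_le_sup supE.2); exists n.
rewrite (@big_cat_nat _ _ _ (maxn N0 N)) ?leq_maxl 1?ltnW//=.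
have : \sum_(N0 <= k < N) eps k <= \sum_(N0 <= k < maxn N0 N) eps k.
  by have [NN|//] := leqP N N0; rewrite big_geq// sumr_ge0.
lra.
Qed.

Lemma bounded_sums_cvg0 C N0 : (forall n, \sum_(N0 <= k < n) eps k <= C) ->
  eps n @[n --> \oo] --> 0.
Proof.
move=> epsC; apply/cvgr0Pnorm_le => z z0.
have [N _ Nz] := bounded_sums_tail epsC z0; near=> n.
rewrite ger0_norm//; apply: le_trans (Nz n.+1).
rewrite big_nat_recr/= ?lerDr ?sumr_ge0//.
by near: n; exists N.
Unshelve. all: by end_near. Qed.

(* [K] is the length of the window of past iterates, and [omega] the weight
   that every update puts on the most recent one. *)
Context (K N0 : nat) (a : nat -> R) (omega C : R).
Context (K0 : (0 < K)%N) (a0 : forall n, 0 <= a n) (omega01 : 0 < omega <= 1).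
Context (epsC : forall n, \sum_(N0 <= k < n) eps k <= C).
Context (aS : forall n B, (N0 <= n)%N ->
  (forall k, (n < k + K)%N -> (k <= n)%N -> a k <= B) ->
  a n.+1 <= omega * a n + (1 - omega) * B + eps n).

(** A convex combination of terms never exceeds a bound on them, so beyond the window at [N] only
    the errors accumulate, each counted once. *)
Lemma window_bound N B : (N0 <= N)%N ->
  (forall k, (N < k + K)%N -> (k <= N)%N -> a k <= B) ->
  forall n, (N < n + K)%N -> a n <= B + \sum_(N <= k < n) eps k.
Proof.
move=> N0N aB; elim/ltn_ind => n IH nK.
have [nN|] := leqP n N; first by rewrite big_geq// addr0 aB.
case: n IH nK => // n IH nK Nn; rewrite big_nat_recr//= addrA.
have h k : (n < k + K)%N -> (k <= n)%N ->
    a k <= B + \sum_(N <= k < n) eps k.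
  move=> nk kn; apply: (le_trans (IH _ _ _)) => //; first by lia.
  rewrite lerD2l; have [kN|Nk] := leqP k N.
    by rewrite big_geq// sumr_ge0.
  by rewrite (@big_cat_nat _ _ _ k _ n)//= ?lerDl ?sumr_ge0 1?ltnW.
apply: (le_trans (aS _ h)); first exact: leq_trans N0N _.
rewrite lerD2r; have := h n; rewrite leqnn; move/(_ _ isT).
have -> : (n < n + K)%N by lia.
move=> /(_ isT) hn; have {hn} : omega * a n <=
    omega * (B + \sum_(N <= k < n) eps k).
  by rewrite ler_wpM2l//; case/andP: omega01 => /ltW.
lra.
Qed.

Lemma window_bounded : exists B, forall n, a n <= B.
Proof.
pose B := \sum_(k < N0.+1) a k.
have aB n : (n <= N0)%N -> a n <= B.
  move=> nN; rewrite /B (bigD1 (Ordinal (nN : (n < N0.+1)%N)))//= lerDl.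
  exact: sumr_ge0.
exists (B + C) => n.
have C0 : 0 <= C by apply: le_trans (epsC 0); rewrite sumr_ge0.
have [nN|Nn] := leqP n N0.
  by apply: (le_trans (aB _ nN)); rewrite lerDl.
apply: (le_trans (window_bound (leqnn _) (fun k _ => aB k) _)); first by lia.
by rewrite lerD2l.
Qed.

(* The limit is the limsup [L].  If a late term were below [L - eta], the weight
   on the latest term would keep the next [K] terms below [L] by a margin of
   about [omega ^+ K * eta], hence, by [window_bound], all later terms. *)
Lemma window_cvg : exists L : R, a n @[n --> \oo] --> L.
Proof.
have [B0 aB0] := window_bounded.
(* The eventual upper bounds of [a]; their infimum is its limsup. *)
pose E : set R := [set B | exists N : nat, forall n, (N <= n)%N -> a n <= B].
have infE : has_inf E.
  split; first by exists B0, 0%N.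
  by exists 0 => B [N /(_ N (leqnn N))]; exact: le_trans.
exists (inf E); set L := inf E.
case/andP: omega01 => omega0 omega1.
apply/cvgrPdist_le => eta eta0.
(* After [K] steps the deficit [omega ^+ K * eta] equals [4 * zeta]. It outweighs three losses of
   [zeta]: the excess of late terms over [L], and the errors before and after index [n + K]. So
   [L - zeta] would eventually bound [a], which is absurd. *)
pose zeta := omega ^+ K * eta / 4.
have oK0 : 0 < omega ^+ K by exact: exprn_gt0.
have zeta0 : 0 < zeta by rewrite /zeta divr_gt0// mulr_gt0.
have oK1 : omega ^+ K <= 1 by apply: exprn_ile1 => //; exact: ltW.
have zeta_eta : zeta <= eta by rewrite /zeta; nra.
have [N1 N01 tail] := bounded_sums_tail epsC zeta0.
have [b [N2 bE] bL] := inf_adherent zeta0 infE.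
pose N := maxn N1 N2.
have aL n : (N <= n)%N -> a n <= L + zeta.
  by rewrite geq_max => /andP[_ /bE /le_trans]; apply; exact: ltW.
have tailN M n : (N <= M)%N -> \sum_(M <= k < n) eps k <= zeta.
  move=> NM; have [nM|Mn] := leqP n M; first by rewrite big_geq// ltW.
  apply: le_trans (tail n); rewrite (@big_cat_nat _ _ _ M N1)//= ?(ltnW Mn)//.
    by rewrite lerDr sumr_ge0.
  by rewrite /N in NM; lia.
exists (N + K)%N => // n /= NKn; rewrite ler_norml; apply/andP; split.
  have /aL : (N <= n)%N by lia.
  by lra.
have [//|an] := leP (L - a n) eta.
have drop j : a (n + j)%N <=
    L + zeta - omega ^+ j * eta + \sum_(n <= k < n + j) eps k.
  elim: j => [|j IH]; first by rewrite addn0 big_geq// expr0; lra.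
  have : a (n + j).+1 <= omega * a (n + j)%N + (1 - omega) * (L + zeta)
                         + eps (n + j)%N.
    apply: aS => [|k ? ?]; last by apply: aL; lia.
    by rewrite /N in NKn; lia.
  rewrite addnS big_nat_recr//= ?leq_addr// exprS.
  have S0 : 0 <= \sum_(n <= k < n + j) eps k by exact: sumr_ge0.
  move: IH S0; set S := bigop _ _ _; set e := eps _; set a1 := a _; set a2 := a _.
  set p := _ ^+ _; nra.
suff : inf E <= L + 3 * zeta - omega ^+ K * eta.
  by rewrite -/L /zeta; nra.
apply: (ge_inf infE.2).
exists (n + K)%N => n' nKn'.
pose B := L + 2 * zeta - omega ^+ K * eta.
apply: (@le_trans _ _ (B + \sum_(n + K <= k < n') eps k)).
  apply: window_bound; [by lia| |by lia] => k nk kn.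
  rewrite -(subnKC (_ : n <= k)%N); last by lia.
  apply: (le_trans (drop _)); set j := (k - n)%N.
  have := tailN n (n + j)%N; rewrite (_ : (N <= n)%N); last by lia.
  move=> /(_ isT); set S := bigop _ _ _.
  have : omega ^+ K <= omega ^+ j by apply: ler_wiXn2l => //; [exact: ltW|lia].
  rewrite /B; nra.
have := tailN (n + K)%N n'; rewrite (_ : (N <= n + K)%N); last by lia.
by move=> /(_ isT); rewrite /B; lra.
Qed.
End WindowRecursion.
Lemma bernoulli (s : R) n : 0 <= s <= 1 -> 1 - n%:R * s <= (1 - s) ^+ n.
Proof.
move=> s01; elim: n => [|n IH]; first by rewrite mul0r subr0 expr0.
rewrite exprS -natr1; have : 0 <= n%:R * s :> R by rewrite mulr_ge0//; case/andP: s01.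
move: IH; set p := _ ^+ n; nra.
Qed.

(** The rate is [r = 1 - (1 - rho) / K]. Bernoulli's inequality gives [rho <= r ^+ K], so one factor
    [rho] pays for the at most [K] powers of [r] lost by looking back over the window. *)
Lemma window_linear K N0 (a : nat -> R) rho : (0 < K)%N -> 0 < rho < 1 ->
  (forall n, 0 <= a n) ->
  (forall n B, (N0 <= n)%N ->
    (forall k, (n < k + K)%N -> (k <= n)%N -> a k <= B) ->
    a n.+1 <= rho * B) ->
  exists c r, [/\ 0 <= c, 0 < r < 1 & forall n, a n <= c * r ^+ n].
Proof.
move=> K0 /andP[rho0 rho1] a0 aS; pose s := (1 - rho) / K%:R.
have KR : 0 < K%:R :> R by rewrite ltr0n.
have K1 : 1 <= K%:R :> R by rewrite ler1n.
have sK : K%:R * s = 1 - rho by rewrite /s mulrC divfK// gt_eqF.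
have s0 : 0 < s by rewrite divr_gt0// subr_gt0.
have s1 : s < 1 by nra.
have rK : rho <= (1 - s) ^+ K.
  by apply: le_trans (bernoulli K _); [rewrite sK; lra|apply/andP; split; exact: ltW].
have r0 : 0 < 1 - s by lra.
(* Chosen so that the bound holds by construction on the first [N0 + K + 1] terms, from which the
   induction starts. *)
pose c := \sum_(k < (N0 + K).+1) a k / (1 - s) ^+ k.
have c0 : 0 <= c by apply: sumr_ge0 => k _; rewrite divr_ge0// exprn_ge0// ltW.
exists c, (1 - s); split => //; first by apply/andP; split; lra.
elim/ltn_ind => n IH; have [nN|] := ltnP n (N0 + K).+1.
  rewrite -ler_pdivrMr ?exprn_gt0// /c (bigD1 (Ordinal nN))//= lerDl.
  by apply: sumr_ge0 => k _; rewrite divr_ge0// exprn_ge0// ltW.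
case: n IH => // n IH nN.
have := aS n (c * (1 - s) ^+ (n.+1 - K)%N).
have -> : (N0 <= n)%N by lia.
move=> /(_ isT) h; apply: (le_trans (h _)) => [k nk kn|].
  apply: (le_trans (IH k _)); first by lia.
  rewrite ler_wpM2l//; apply: ler_wiXn2l; [exact: ltW|lra|lia].
rewrite -[in leRHS](@subnK K n.+1); last by lia.
rewrite exprD mulrA [leRHS]mulrC ler_wpM2r//.
by rewrite mulr_ge0// exprn_ge0// ltW.
Qed.

End RealSequences.

(** * Weak sequential compactness and Opial's lemma *)

Section Riesz.
Context {R : realType} {H : hilbertType R}.
Implicit Types (W : set H) (f : H -> R).

Lemma cvg_dot (T : Type) (F : set_system T) (FF : Filter F) (u : T -> H) (y v : H) :
  u n @[n --> F] --> y -> dot (u n) v @[n --> F] --> dot y v.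
Proof.
move=> uy; apply/subr_cvg0/norm_cvg0P.
have uy0 : `|u n - y| * `|v| @[n --> F] --> 0 * `|v|.
  apply: cvgM (cvg_cst _).
  by apply/norm_cvg0P/subr_cvg0.
rewrite mul0r in uy0; apply: (squeeze_cvgr _ (cvg_cst 0) uy0).
by apply: nearW => n /=; rewrite normr_ge0/= -dotNl -dotDl norm_dot_le.
Qed.

(* The representative minimizes [J u = |u|^2 - 2 f u] over [W]; a minimizing
   sequence is Cauchy by the parallelogram law. *)
Lemma riesz_subspace W f C : W 0 ->
  (forall a u v, W u -> W v -> W (a *: u + v)) -> closed W ->
  (forall a u v, W u -> W v -> f (a *: u + v) = a * f u + f v) ->
  (forall u, W u -> `|f u| <= C * `|u|) ->
  exists2 y, W y & forall v, W v -> f v = dot y v.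
Proof.
move=> W0 Wlin Wcl flin fC.
have WZ a u : W u -> W (a *: u) by move=> Wu; rewrite -[_ *: _]addr0; exact: Wlin.
have f0 : f 0 = 0 by have := flin 1 0 0 W0 W0; rewrite scaler0 addr0; lra.
have fZ a u : W u -> f (a *: u) = a * f u.
  by move=> Wu; have := flin a u 0 Wu W0; rewrite f0 !addr0.
pose J u : R := `|u| ^+ 2 - 2 * f u.
have JW : has_inf (J @` W).
  split; first by exists (J 0), 0.
  (* [J u >= |u|^2 - 2 C |u| = (|u| - C)^2 - C^2]. *)
  exists (- C ^+ 2) => _ [u /fC + <-]; rewrite ler_norml /J => /andP[_].
  by have := sqr_ge0 (`|u| - C); nra.
pose d := inf (J @` W).
have Jd u : W u -> d <= J u by move=> Wu; apply: (ge_inf JW.2); exists u.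
have /choice[v_ vP] n : exists u, W u /\ J u < d + harmonic n.
  by have [_ [u Wu <-] ud] := inf_adherent (@harmonic_gt0 R n) JW; exists u.
have v_close p q : `|v_ p - v_ q| ^+ 2 <= 2 * (harmonic p + harmonic q).
  have [[Wp Jp] [Wq Jq]] := (vP p, vP q).
  have := Jd _ (WZ 2^-1 _ (Wlin 1 _ _ Wp Wq)).
  rewrite /J fZ ?flin//; last exact: Wlin.
  move: Jp Jq; rewrite /J scale1r -!dot_norm !dotE (dotC (v_ q)).
  set x := dot (v_ p) (v_ p); set y := dot (v_ q) (v_ q); set z := dot _ _.
  lra.
have : cauchy (v_ @ \oo).
  apply: cauchy_exP => e e0.
  have : 0 < e ^+ 2 / 4 by rewrite divr_gt0// exprn_gt0.
  move/cvgr0Pnorm_lt : (@cvg_harmonic R) => /[apply] -[N _ Nh].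
  exists (v_ N), N => // n /= Nn; rewrite -ball_normE/=.
  rewrite -(@ltr_pXn2r _ 2%N) ?nnegrE ?(ltW e0)//.
  apply: (le_lt_trans (v_close _ _)).
  have := Nh _ Nn; have := Nh _ (leqnn N).
  rewrite !ger0_norm ?harmonic_ge0//=; move: (N.+1%:R^-1) (n.+1%:R^-1) => p q; lra.
move=> /cauchy_cvg /cvg_ex[/= y vy].
exists y => [|v Wv].
  by apply: (@closed_cvg _ _ _ _ v_ W Wcl _ y vy); apply: nearW => n; exact: (vP n).1.
have gap n : (`|v| ^+ 2 + 1)^-1 * `|dot (v_ n) v - f v| ^+ 2 <= harmonic n.
  have q0 : 0 < `|v| ^+ 2 + 1 by rewrite ltr_wpDl// sqr_ge0.
  have [Wn Jn] := vP n.
  (* Compare [J] at [v_ n + s v] with the infimum: [g] is half the derivative at [s = 0]. The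
     optimal step would divide by [|v|^2]; adding 1 also covers [v = 0]. *)
  set g := dot (v_ n) v - f v; pose s := - g / (`|v| ^+ 2 + 1).
  have := Jd _ (Wlin s _ _ Wv Wn).
  move: Jn; rewrite /J flin// -!dot_norm !dotE (dotC v) dot_norm (dot_norm v).
  rewrite real_normK ?num_real//.
  have sq : s * (`|v| ^+ 2 + 1) = - g by rewrite /s divfK// gt_eqF.
  have -> : (`|v| ^+ 2 + 1)^-1 * g ^+ 2 = - s * g by rewrite /s; ring.
  rewrite (_ : dot (v_ n) v = g + f v); last by rewrite /g; ring.
  move: sq; set q := `|v| ^+ 2; set h := harmonic n; clearbody s g; nra.
have : dot (v_ n) v - f v @[n --> \oo] --> 0.
  apply: (@cvg0_sqr _ R^o _ _ _ _ (nearW _ gap)); last exact: cvg_harmonic.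
  by rewrite invr_gt0 ltr_wpDl// sqr_ge0.
move/subr_cvg0 => h.
by apply: (cvg_unique _ h); [exact: Rhausdorff|exact: cvg_dot].
Qed.

End Riesz.

Section WeakConvergence.
Context {R : realType} {H : hilbertType R}.
Implicit Types (x : nat -> H).

(** Compactness of the segment supplies a cluster point, and an ultrafilter converges to each of its
    cluster points. *)
Lemma ultrafilter_cvg_segment (U : set_system nat) (u : nat -> R) M :
  UltraFilter U -> (forall n, `|u n| <= M) ->
  exists l : R, `|l| <= M /\ u n @[n --> U] --> l.
Proof.
move=> UU uM.
have UuM : (u @ U) `[- M, M]%classic.
  apply: (@filterS _ U _ setT); last exact: filterT.
  by move=> n _ /=; rewrite in_itv/= -ler_norml.
have [l []] := segment_compact (fmap_proper_filter _ _) UuM.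
rewrite /= in_itv/= -ler_norml => lM lcl; exists l; split => // B lB.
have [//|UB] := in_ultra_setVsetC (u @^-1` B) UU.
have [r [/= nBr Br]] := lcl (~` B) B UB lB.
by case: (nBr Br).
Qed.

Lemma weak_cvg_subspace_closed x (y : H) C : (forall n, `|x n| <= C) ->
  closed [set v | dot (x n) v @[n --> \oo] --> dot y v].
Proof.
move=> xC v clv; apply/cvgrPdist_lt => e e0.
(* This constant bounds every [|y - x n|]; the summand 1 keeps it positive for the division. *)
have C0 : 0 < C + `|y| + 1.
  by have := xC 0%N; have := normr_ge0 (x 0%N); have := normr_ge0 y; lra.
have e20 : 0 < e / 2 by lra.
have [w [/= /cvgrPdist_lt/(_ _ e20) w_near]] :=
  clv _ (nbhsx_ballx v _ (divr_gt0 e20 C0)).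
rewrite -ball_normE/= ltr_pdivlMr// => vw; near=> n.
have -> : dot y v - dot (x n) v =
    (dot y w - dot (x n) w) + dot (y - x n) (v - w) by rewrite !dotE; ring.
apply: (le_lt_trans (ler_normD _ _)).
have h1 : `|dot y w - dot (x n) w| < e / 2 by near: n.
have h2 := norm_dot_le (y - x n) (v - w).
have h3 : `|y - x n| <= C + `|y| + 1.
  by apply: (le_trans (ler_normB _ _)); have := xC n; lra.
have h4 : `|y - x n| * `|v - w| <= (C + `|y| + 1) * `|v - w| by rewrite ler_wpM2r.
by move: vw; rewrite mulrC; lra.
Unshelve. all: by end_near. Qed.

(* The limit functional along a free ultrafilter is represented by some [y].
   The [N]-th index of the subsequence is chosen so that [x (k N)] is
   [1/(N+1)]-close to [y] when tested against [x 0, ..., x N]; projecting onto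
   the closed subspace of good test vectors then handles all test vectors. *)
Lemma bounded_weak_seq_cluster x C : (forall n, `|x n| <= C) ->
  exists y, weak_seq_cluster x y.
Proof.
move=> xC; have [U [UU sU]] := ultraFilterLemma eventually_filter.
have /choice[f fP] v : exists l : R,
    `|l| <= C * `|v| /\ dot (x n) v @[n --> U] --> l.
  apply: ultrafilter_cvg_segment => n.
  by apply: (le_trans (norm_dot_le _ _)); rewrite ler_wpM2r.
have [a u v _ _|v _|y _ yf] :=
  @riesz_subspace R H setT f C I (fun _ _ _ _ _ => I) closedT.
- apply: (cvg_unique _ (fP _).2); first exact: Rhausdorff.
  move=> /=; under eq_fun do rewrite dotDr dotZr.
  by apply: cvgD (fP v).2; apply: cvgM (cvg_cst _) (fP u).2.
- exact: (fP v).1.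
have yU v : dot (x n) v @[n --> U] --> dot y v by rewrite -yf//; exact: (fP v).2.
have [N n|k kincr kP] := @subseq_choice (fun N k =>
    forall j : 'I_N.+1, `|dot y (x j) - dot (x k) (x j)| < harmonic N).
  have : \forall k \near U, (n <= k)%N /\
      forall j : 'I_N.+1, `|dot y (x j) - dot (x k) (x j)| < harmonic N.
    apply: filterI; first by apply: sU; exists n.
    apply: filter_forall => j.
    by have /cvgrPdist_lt/(_ _ (harmonic_gt0 N)) := yU (x j).
  by move=> /filter_ex[k [nk kP]]; exists k.
pose W := [set v | dot (x (k n)) v @[n --> \oo] --> dot y v].
have Wx j : W (x j).
  apply/cvgrPdist_lt => e e0.
  move/cvgr0Pnorm_lt : (@cvg_harmonic R) => /(_ _ e0) he; near=> n.
  have jn : (j < n.+1)%N by rewrite ltnS; near: n; exists j.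
  apply: (lt_trans (kP n (Ordinal jn))); apply: (le_lt_trans (ler_norm _)).
  by near: n.
have W0 : W 0.
  by rewrite /W/= dot0r; under eq_fun do rewrite dot0r; exact: cvg_cst.
have Wlin a u v : W u -> W v -> W (a *: u + v).
  rewrite /W/= dotDr dotZr => Wu Wv; under eq_fun do rewrite dotDr dotZr.
  by apply: cvgD Wv; apply: cvgM (cvg_cst _) Wu.
have Wcl : closed W by apply: (@weak_cvg_subspace_closed (x \o k) y C) => n; exact: xC.
exists y, k => // z.
(* Here [w] is the projection of [z] onto [W]: since every [x j] lies in [W], testing against [z] or
   [w] gives the same values, and the same holds for [y] by passing to the limit along [U]. *)
have [a u v _ _|v _|w Ww wz] := @riesz_subspace R H W (dot z) `|z| W0 Wlin Wcl.
- by rewrite dotDr dotZr.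
- exact: norm_dot_le.
have xz j : dot (x j) z = dot (x j) w by rewrite dotC wz// dotC.
have -> : dot y z = dot y w.
  apply: (cvg_unique _ (yU z)); first exact: Rhausdorff.
  by move=> /=; under eq_fun do rewrite xz; exact: yU.
by under eq_fun do rewrite /= xz; exact: Ww.
Unshelve. all: by end_near. Qed.

(** Expanding [|x n - y|^2 - |x n - z|^2] shows that [dot (x n) (y - z)] converges. Its limits along
    the two subsequences agree, so [dot y (y - z) = dot z (y - z)]. *)
Lemma weak_seq_cluster_unique x (y z : H) (Ly Lz : R) :
  `|x n - y| @[n --> \oo] --> Ly -> `|x n - z| @[n --> \oo] --> Lz ->
  weak_seq_cluster x y -> weak_seq_cluster x z -> y = z.
Proof.
move=> xy xz [k kincr ky] [l lincr lz].
have [c xc] : exists c : R, dot (x n) (y - z) @[n --> \oo] --> c.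
  exists (2^-1 * ((`|y| ^+ 2 - `|z| ^+ 2) - (Ly ^+ 2 - Lz ^+ 2))).
  rewrite (_ : (fun n => _) = (fun n => 2^-1 * ((`|y| ^+ 2 - `|z| ^+ 2) -
      (`|x n - y| ^+ 2 - `|x n - z| ^+ 2)))); last first.
    apply/funext => n; rewrite -!dot_norm !dotE (dotC y (x n)) (dotC z (x n)).
    by field.
  apply: cvgM (cvg_cst _) _; apply: cvgB (cvg_cst _) _.
  by apply: cvgB; apply: cvg_sqr.
have sub m w : increasing_seq m -> weak_cvg (x \o m) w -> dot w (y - z) = c.
  move=> /cvgn_increasing moo /(_ (y - z)) h.
  apply: (cvg_unique _ h); first exact: Rhausdorff.
  exact: (cvg_comp _ _ moo xc).
apply/eqP; rewrite -subr_eq0 -normr_eq0 -sqrf_eq0 -dot_norm dotDl dotNl.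
by rewrite (sub k y)// (sub l z)// subrr.
Qed.

(** If the whole sequence failed to converge weakly to the cluster point [y], some test vector would
    keep a subsequence away from [y]; that subsequence has a weak cluster point of its own, which
    must be [y]. *)
Lemma opial x (S : set H) :
  (exists C, forall n, `|x n| <= C) ->
  (forall y, S y -> exists L : R, `|x n - y| @[n --> \oo] --> L) ->
  (forall y, weak_seq_cluster x y -> S y) ->
  exists2 y, S y & weak_cvg x y.
Proof.
move=> [C xC] fejer clS.
have [y xy] := bounded_weak_seq_cluster xC.
exists y; first exact: clS.
move=> v; apply/cvgrPdist_lt => e e0; apply: contrapT => nev.
have [N n|k kincr kP] := @subseq_choice (fun _ k =>
    e <= `|dot y v - dot (x k) v|).
  apply: contrapT => nex; apply: nev; exists n => // k /= nk.
  by rewrite ltNge; apply/negP => ek; apply: nex; exists k.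
have [z [l lincr lz]] := bounded_weak_seq_cluster (fun n => xC (k n)).
have xz : weak_seq_cluster x z.
  by exists (k \o l) => // i j /=; rewrite kincr; exact: lincr.
have [[Ly xLy] [Lz xLz]] := (fejer _ (clS _ xy), fejer _ (clS _ xz)).
have yz := weak_seq_cluster_unique xLy xLz xy xz.
rewrite -yz in lz; have /cvgrPdist_lt/(_ _ e0)[N _ /(_ N (leqnn N))] := lz v.
by rewrite /= ltNge kP.
Qed.

End WeakConvergence.

(** * Asymptotics of perturbed iterations with delays *)

Section Asymptotics.
Context {R : realType} {H : hilbertType R}.

Lemma firm_nonexpansive (eps : R) (T : H -> H) u v : 0 < eps -> firm eps T ->
  `|T u - T v| <= `|u - v|.
Proof.
move=> eps0 /(_ u v) Tuv; rewrite -(@ler_pXn2r _ 2%N) ?nnegrE//.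
by apply: le_trans Tuv; rewrite lerDl mulr_ge0 ?sqr_ge0 ?ltW.
Qed.

(* [d i n] is the delayed iterate fed to the operator [F i n], and [L] is the
   common limit of all the distances to the fixed point [x]. *)
Context (m : nat) (omega : 'I_m -> R) (eps : R) (N0 : nat).
Context (F0 : nat -> H -> H) (F : 'I_m -> nat -> H -> H).
Context (x_ e0 : nat -> H) (d e : 'I_m -> nat -> H) (x : H) (L : R).
Context (omega0 : forall i, 0 < omega i) (omega1 : \sum_i omega i = 1).
Context (eps0 : 0 < eps).
Context (F0_firm : forall n, (N0 <= n)%N -> firm eps (F0 n)).
Context (F_firm : forall i n, (N0 <= n)%N -> firm eps (F i n)).
Context (x_S : forall n, (N0 <= n)%N ->
  x_ n.+1 = F0 n (\sum_i omega i *: (F i n (d i n) + e i n)) + e0 n).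
Context (x_fix : forall n, (N0 <= n)%N -> F0 n (\sum_i omega i *: F i n x) = x).
Context (e0_cvg : `|e0 n| @[n --> \oo] --> 0).
Context (e_cvg : forall i, `|e i n| @[n --> \oo] --> 0).
Context (x_L : `|x_ n - x| @[n --> \oo] --> L).
Context (d_L : forall i, `|d i n - x| @[n --> \oo] --> L).
Context (hit : forall n, (N0 <= n)%N -> exists i, d i n = x_ n).

Let z i n := F i n (d i n) - F i n x.
Let c n := \sum_i omega i *: z i n.
Let err n := \sum_i omega i * `|e i n|.
Let u n := \sum_i omega i *: (F i n (d i n) + e i n).
Let v n := \sum_i omega i *: F i n x.
Let r i n := (d i n - F i n (d i n)) - (x - F i n x).

Let omega_ge0 i : 0 <= omega i. Proof. exact: ltW. Qed.

Let err_cvg : err n @[n --> \oo] --> 0.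
Proof.
apply: cvg0_sum => i; rewrite -(mulr0 (omega i)).
by apply: cvgM (cvg_cst _) (e_cvg i).
Qed.

Let sum_L (f : 'I_m -> nat -> R) (l : R) :
  (forall i, f i n @[n --> \oo] --> l) ->
  \sum_i omega i * f i n @[n --> \oo] --> l.
Proof.
move=> fl; have -> : l = \sum_i omega i * l by rewrite -mulr_suml omega1 mul1r.
by apply: cvg_sumr => i; apply: cvgM (cvg_cst _) (fl i).
Qed.

Let uvE n : u n - v n = c n + \sum_i omega i *: e i n.
Proof.
rewrite /u /v /c -sumrB -big_split/=; apply: eq_bigr => i _.
by rewrite -scalerBr -scalerDr /z addrAC.
Qed.

Lemma norm_uv n : `|u n - v n| <= `|c n| + err n.
Proof.
rewrite uvE; apply: (le_trans (ler_normD _ _)).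
by rewrite lerD2l convex_norm.
Qed.

Lemma norm_z i n : (N0 <= n)%N -> `|z i n| <= `|d i n - x|.
Proof. by move=> Nn; exact: (firm_nonexpansive _ _ eps0 (F_firm i Nn)). Qed.

Lemma norm_c n : (N0 <= n)%N -> `|c n| <= \sum_i omega i * `|d i n - x|.
Proof.
move=> Nn; apply: (le_trans (convex_norm _ omega_ge0)).
by apply: ler_sum => i _; rewrite ler_wpM2l// norm_z.
Qed.

Lemma norm_F0 n : (N0 <= n)%N -> `|F0 n (u n) - x| <= `|u n - v n|.
Proof.
move=> Nn; rewrite -{1}(x_fix Nn).
exact: (firm_nonexpansive _ _ eps0 (F0_firm Nn)).
Qed.

Lemma norm_xS n : (N0 <= n)%N ->
  `|x_ n.+1 - x| - `|e0 n| <= `|F0 n (u n) - x|.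
Proof.
by move=> Nn; rewrite x_S// lerBlDr addrAC ler_normD.
Qed.

Lemma norm_step n : (N0 <= n)%N -> `|x_ n.+1 - x| <=
  \sum_i omega i * `|d i n - x| + (`|e0 n| + \sum_i omega i * `|e i n|).
Proof.
move=> Nn; have := norm_xS Nn; have := norm_F0 Nn; have := norm_uv n.
by have := norm_c Nn; rewrite -/(err n); lra.
Qed.

Let lower_cvg : `|x_ n.+1 - x| - `|e0 n| @[n --> \oo] --> L.
Proof.
rewrite -(subr0 L); apply: cvgB e0_cvg.
by rewrite -[X in X --> _]/([sequence (fun k => `|x_ k - x|) n.+1]_n @ \oo) cvg_shiftS.
Qed.

Lemma c_cvg : `|c n| @[n --> \oo] --> L.
Proof.
have lower : `|x_ n.+1 - x| - `|e0 n| - err n @[n --> \oo] --> L.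
  by rewrite -(subr0 L); apply: cvgB err_cvg.
apply: (squeeze_cvgr _ lower (sum_L d_L)).
exists N0 => // n /= Nn; rewrite norm_c// andbT lerBlDr.
apply: le_trans (norm_uv n); apply: le_trans (norm_F0 Nn).
exact: norm_xS.
Qed.

Let upper_cvg : `|c n| + err n @[n --> \oo] --> L.
Proof. by rewrite -(addr0 L); apply: cvgD c_cvg err_cvg. Qed.

Lemma residual0_cvg :
  (u n - F0 n (u n)) - (v n - x) @[n --> \oo] --> (0 : H).
Proof.
have uL : `|u n - v n| @[n --> \oo] --> L.
  apply: (squeeze_cvgr _ lower_cvg upper_cvg).
  exists N0 => // n /= Nn; rewrite norm_uv andbT.
  by apply: le_trans (norm_F0 Nn); exact: norm_xS.
have FL : `|F0 n (u n) - x| @[n --> \oo] --> L.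
  apply: (squeeze_cvgr _ lower_cvg uL).
  by exists N0 => // n /= Nn; rewrite norm_xS// norm_F0.
apply: (@cvg0_sqr _ _ _
  (fun n => `|u n - v n| ^+ 2 - `|F0 n (u n) - x| ^+ 2) eps eps0).
  exists N0 => // n /= Nn; have := F0_firm Nn (u n) (v n).
  by rewrite (x_fix Nn); lra.
by apply: (@cvg0_sub _ _ _ (L ^+ 2)); exact: cvg_sqr.
Qed.

Let z2_le n : (N0 <= n)%N ->
  `|c n| ^+ 2 <= \sum_i omega i * `|z i n| ^+ 2 <=
    \sum_i omega i * `|d i n - x| ^+ 2.
Proof.
move=> Nn; apply/andP; split.
  rewrite -subr_ge0 -variance//.
  by apply: sumr_ge0 => i _; rewrite mulr_ge0 ?sqr_ge0.
apply: ler_sum => i _; rewrite ler_wpM2l// ler_pXn2r ?nnegrE//.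
exact: norm_z.
Qed.

Let d2_cvg : \sum_i omega i * `|d i n - x| ^+ 2 @[n --> \oo] --> L ^+ 2.
Proof. by apply: sum_L => i; exact: cvg_sqr. Qed.

Let z2_cvg : \sum_i omega i * `|z i n| ^+ 2 @[n --> \oo] --> L ^+ 2.
Proof.
by apply: (squeeze_cvgr _ (cvg_sqr c_cvg) d2_cvg); exists N0.
Qed.

Lemma deviation_cvg i : z i n - c n @[n --> \oo] --> (0 : H).
Proof.
apply: (@cvg0_sqr _ _ _ (fun n => \sum_i omega i * `|z i n| ^+ 2 - `|c n| ^+ 2)
          (omega i) (omega0 i)).
  apply: nearW => n; rewrite -variance// (bigD1 i)//= lerDl.
  by apply: sumr_ge0 => j _; rewrite mulr_ge0 ?sqr_ge0.
by apply: (cvg0_sub z2_cvg); exact: (cvg_sqr c_cvg).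
Qed.

Lemma residual_cvg i : r i n @[n --> \oo] --> (0 : H).
Proof.
apply: (@cvg0_sqr _ _ _ (fun n => \sum_i omega i * `|d i n - x| ^+ 2
   - \sum_i omega i * `|z i n| ^+ 2) (omega i * eps)); first exact: mulr_gt0.
  exists N0 => // n /= Nn; rewrite -sumrB (bigD1 i)//=.
  have h j : omega j * eps * `|r j n| ^+ 2 <=
      omega j * `|d j n - x| ^+ 2 - omega j * `|z j n| ^+ 2.
    by rewrite -mulrBr -mulrA ler_wpM2l// lerBrDl; exact: F_firm.
  (* The gap of every other index is nonnegative, so the total gap dominates that of [i]. *)
  rewrite -[leLHS]addr0; apply: lerD (h i) _.
  apply: sumr_ge0 => j _; apply: le_trans (h j).
  by rewrite !mulr_ge0 ?sqr_ge0// ltW.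
exact: (cvg0_sub d2_cvg z2_cvg).
Qed.

(** One radius for all indices: every delayed iterate lies within [G n] of the same point [x + c n],
    and by [hit] so does [x_ n]. *)
Let G n := \sum_i (`|r i n| + `|z i n - c n|).

Let G_cvg : G n @[n --> \oo] --> 0.
Proof.
apply: cvg0_sum => i; rewrite -(addr0 0).
by apply: cvgD; apply/norm_cvg0P; [exact: residual_cvg|exact: deviation_cvg].
Qed.

Let d_G i n : `|d i n - x - c n| <= G n.
Proof.
have -> : d i n - x - c n = r i n + (z i n - c n).
  have -> : r i n = d i n - x - z i n by rewrite /r /z opprD addrACA -opprD.
  by rewrite addrA subrK.
apply: (le_trans (ler_normD _ _)); rewrite /G (bigD1 i)//= lerDl.
by apply: sumr_ge0 => j _; rewrite addr_ge0.
Qed.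

Let x_G n : (N0 <= n)%N -> `|x_ n - x - c n| <= G n.
Proof. by move=> /hit[i <-]. Qed.

Lemma delayed_cvg i : d i n - x_ n @[n --> \oo] --> (0 : H).
Proof.
apply: (@cvg0_le _ _ _ (fun n => G n + G n)).
  exists N0 => // n /= Nn.
  have -> : d i n - x_ n = (d i n - x - c n) - (x_ n - x - c n).
    by rewrite -!(addrA _ (- x)) opprD addrACA subrr addr0.
  by apply: (le_trans (ler_normB _ _)); rewrite lerD ?x_G.
by rewrite -(addr0 0); exact: cvgD.
Qed.

Lemma outer_residual_cvg :
  x_ n - F0 n (\sum_i omega i *: F i n (x_ n)) @[n --> \oo] --> (0 : H).
Proof.
pose D n := \sum_i omega i * `|d i n - x_ n|.
pose q n := (u n - F0 n (u n)) - (v n - x).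
have D0 : D n @[n --> \oo] --> 0.
  apply: sum_L => i; apply/norm_cvg0P; exact: delayed_cvg.
have q0 : `|q n| @[n --> \oo] --> 0 by apply/norm_cvg0P; exact: residual0_cvg.
apply: (@cvg0_le _ _ _ (fun n => G n + `|q n| + err n + (D n + err n))); last first.
  rewrite -(addr0 0); apply: cvgD; rewrite -(addr0 0); apply: cvgD => //.
  by rewrite -(addr0 0); exact: cvgD.
exists N0 => // n /= Nn; set w := \sum_i _.
(* The first piece is controlled by [G], the second equals [c n - (F0 n (u n) - x)] and vanishes
   with [q] and the errors, the third is handled by nonexpansiveness of [F0 n]. *)
have -> : x_ n - F0 n w =
    (x_ n - x - c n) + (q n - \sum_i omega i *: e i n) + (F0 n (u n) - F0 n w).
  have -> : q n = c n + \sum_i omega i *: e i n - (F0 n (u n) - x).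
    by rewrite /q opprD addrACA -opprD uvE.
  rewrite opprB (addrAC (c n)) -!addrA (addrA (\sum_i omega i *: e i n)).
  by rewrite subrr add0r !addKr.
apply: (le_trans (ler_normD _ _)); apply: lerD.
  apply: (le_trans (ler_normD _ _)); rewrite -[leRHS]addrA.
  apply: lerD (x_G Nn) _.
  by apply: (le_trans (ler_normB _ _)); rewrite lerD2l convex_norm.
apply: (le_trans (firm_nonexpansive _ _ eps0 (F0_firm Nn))).
have -> : u n - w = \sum_i omega i *: (F i n (d i n) - F i n (x_ n))
    + \sum_i omega i *: e i n.
  rewrite /u /w -sumrB -big_split/=; apply: eq_bigr => i _.
  by rewrite -scalerBr -scalerDr addrAC.
apply: (le_trans (ler_normD _ _)); apply: lerD; last exact: convex_norm.
apply: (le_trans (convex_norm _ omega_ge0)).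
apply: ler_sum => i _; rewrite ler_wpM2l//.
exact: (firm_nonexpansive _ _ eps0 (F_firm i Nn)).
Qed.

End Asymptotics.

(** * Latest activation times *)

(** For the linear rate: the Lipschitz constants are available from index [K - 1] on, and they are
    needed at delayed indices. *)
Lemma window_start K n k : (K + K <= n)%N -> (n < k + K)%N -> (K - 1 <= k)%N.
Proof. lia. Qed.

Section LatestActivation.
Context (m K : nat) (I : nat -> {set 'I_m}).
Context (I_cover : forall n,
  (\bigcup_(k < K) I (n + k)%N)%SET = [set: 'I_m]%SET).

Lemma ell_ge i n k : (n < k + K)%N -> (k <= n)%N -> i \in I k ->
  (k <= ell I K i n)%N.
Proof.
move=> nk kn ik; rewrite /ell.
apply: (@leq_bigmax_seq _ _ (fun k => i \in I k) id k) => //.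
by rewrite mem_index_iota; lia.
Qed.

Lemma ellP i n : (K - 1 <= n)%N ->
  [/\ i \in I (ell I K i n), (n < ell I K i n + K)%N & (ell I K i n <= n)%N].
Proof.
move=> Kn; have : i \in [set: 'I_m]%SET by rewrite inE.
rewrite -(I_cover (n.+1 - K)) => /bigcupP[j _ ij].
have jK := ltn_ord j.
set k0 := (n.+1 - K + j)%N in ij.
have k0ell : (k0 <= ell I K i n)%N by apply: ell_ge => //; rewrite /k0; lia.
(* A maximum is either the default 0 or attained. In the first case the active index
   [k0 <= ell I K i n] is itself 0, so the value 0 is still correct. *)
have [ell0|//] : ell I K i n = 0%N \/
  [/\ i \in I (ell I K i n), (n < ell I K i n + K)%N & (ell I K i n <= n)%N].
  rewrite {k0ell} /ell big_nat_cond.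
  elim/big_ind: _ => [|p q IHp IHq|k /andP[/andP[k1 k2] ik]]; first by left.
    by case: (leqP p q).
  by right; split => //; lia.
have k00 : k0 = 0%N by lia.
by rewrite ell0 -k00; split => //; rewrite /k0; lia.
Qed.

Lemma ell_eq i n : (0 < K)%N -> (K - 1 <= n)%N -> i \in I n -> ell I K i n = n.
Proof.
move=> K0 Kn iIn; have [_ _ ln] := ellP i Kn.
by apply/eqP; rewrite eqn_leq ln ell_ge//; lia.
Qed.

Lemma cvg_ell i : ell I K i n @[n --> \oo] --> \oo.
Proof.
apply/cvgnyPge => A; exists (A + K)%N => // n /= An.
have Kn : (K - 1 <= n)%N by lia.
by have [_ nl _] := ellP i Kn; lia.
Qed.

(** By maximality of [ell], block [i] stays inactive and frozen after that time; the initial values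
    are forgotten since each block is activated during the first [K] steps. *)
Lemma block_ellE (V : zmodType) (t : 'I_m -> nat -> V)
    (f : 'I_m -> nat -> V) (t0 : 'I_m -> V) :
  (forall n i, t i n =
    if i \in I n then f i n else if n is n'.+1 then t i n' else t0 i) ->
  forall i n, (K - 1 <= n)%N -> t i n = f i (ell I K i n).
Proof.
move=> tE i n Kn; have [il nl ln] := ellP i Kn.
have stay k : (ell I K i n <= k)%N -> (k <= n)%N -> t i k = f i (ell I K i n).
  elim: k => [|k IH] lk kn.
    by rewrite tE; move: lk il; rewrite leqn0 => /eqP ->  ->.
  move: lk; rewrite leq_eqVlt => /predU1P[<-|lk]; first by rewrite tE il.
  rewrite tE ifF ?IH//; first exact: ltnW.
  by apply: (contraTF _ lk) => ik; rewrite -leqNgt ell_ge//; lia.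
exact: stay.
Qed.

End LatestActivation.

(** * Convergence of the block-iterative algorithm *)

Lemma convex_window (R : realType) m (omega f : 'I_m -> R) w A B i :
  (forall j, 0 < omega j) -> \sum_j omega j = 1 -> w <= omega i ->
  f i = A -> A <= B -> (forall j, f j <= B) ->
  \sum_j omega j * f j <= w * A + (1 - w) * B.
Proof.
move=> o0 o1 wi fi AB fB; rewrite (bigD1 i)//= fi.
have : \sum_(j | j != i) omega j * f j <= (1 - omega i) * B.
  have <- : \sum_(j | j != i) omega j = 1 - omega i.
    by rewrite -o1 [in RHS](bigD1 i)//= [RHS]addrC addKr.
  rewrite mulr_suml.
  by apply: ler_sum => j _; rewrite ler_wpM2l// ltW.
(* Since [A <= B], moving the excess weight [omega i - w] from [A] to [B] only enlarges the
   bound. *)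
nra.
Qed.

Lemma nneseries_bounded (R : realType) (u : nat -> R) N0 :
  (forall n, 0 <= u n) -> (\sum_(N0 <= n <oo) (u n)%:E < +oo)%E ->
  exists C, forall n, \sum_(N0 <= k < n) u k <= C.
Proof.
move=> u0 uoo; set S := (limn _) in uoo.
have uS n : ((\sum_(N0 <= k < n) u k)%:E <= S)%E.
  by rewrite -sumEFin; apply: nneseries_lim_ge => k _ _; rewrite lee_fin.
have Sfin : S \is a fin_num.
  by rewrite ge0_fin_numE//; apply: le_trans (uS 0%N); rewrite lee_fin big_geq.
by exists (fine S) => n; rewrite -lee_fin fineK.
Qed.

Theorem theorem3p2 (R : realType) (H : hilbertType R)
  (m : nat) (m_gt0 : (0 < m)%N)
  (omega : 'I_m -> R)
  (omega_bnd : forall i, 0 < omega i <= 1)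
  (omega_sum : \sum_(i < m) omega i = 1)
  (alpha0 : R) (T0 : H -> H)
  (alpha0_bnd : 0 < alpha0 < 1) (T0_avg : averaged alpha0 T0)
  (alpha : 'I_m -> R) (T : 'I_m -> H -> H)
  (alpha_bnd : forall i, 0 < alpha i < 1)
  (T_avg : forall i, averaged (alpha i) (T i))
  (K : nat) (K_gt0 : (0 < K)%N)
  (I : nat -> {set 'I_m})
  (I_neq0 : forall n, I n != finset.set0)
  (I_cover : forall n, (\bigcup_(k < K) I (n + k)%N)%SET = [set: 'I_m]%SET)
  (e0 : nat -> H) (e : 'I_m -> nat -> H)
  (e0_sum : (\sum_((K - 1)%N <= n <oo) `|e0 n|%:E < +oo)%E)
  (e_sum : forall i,
    (\sum_((K - 1)%N <= n <oo) `|e i (ell I K i n)|%:E < +oo)%E)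
  (eps : R) (eps_bnd : 0 < eps < 1)
  (alpha0n : nat -> R) (T0n : nat -> H -> H)
  (alpha0n_bnd : forall n, 0 < alpha0n n < 1 / (1 + eps))
  (T0n_avg : forall n, averaged (alpha0n n) (T0n n))
  (alphan : 'I_m -> nat -> R) (Tn : 'I_m -> nat -> H -> H)
  (alphan_bnd : forall n i, i \in I n -> 0 < alphan i n < 1 / (1 + eps))
  (Tn_avg : forall n i, i \in I n -> averaged (alphan i n) (Tn i n))
  (Fix_sub : forall n, (K - 1 <= n)%N ->
    Fix (T0 \o wsum omega T) !=set0 /\
    Fix (T0 \o wsum omega T)
      `<=` Fix (T0n n \o wsum omega (fun i => Tn i (ell I K i n))))
  (x0 : H) (tinit : 'I_m -> H)
  (t : 'I_m -> nat -> H) (x_ : nat -> H)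
  (x_0 : x_ 0%N = x0)
  (t_eq : forall n i, t i n =
    if i \in I n then Tn i n (x_ n) + e i n
    else if n is n'.+1 then t i n' else tinit i)
  (x_S : forall n,
    x_ n.+1 = T0n n (\sum_(i < m) omega i *: t i n) + e0 n)
  (x : H) (x_sol : Fix (T0 \o wsum omega T) x) :
  (* (i) *)
  bounded_fun x_ /\
  (* (ii) *)
  (forall i : 'I_m, let l := ell I K i in
    x_ (l n) - Tn i (l n) (x_ (l n)) + Tn i (l n) x - x @[n --> \oo]
      --> (0 : H)) /\
  (* (iii) *)
  (forall i j : 'I_m, let li := ell I K i in let lj := ell I K j in
    Tn i (li n) (x_ (li n)) - Tn j (lj n) (x_ (lj n))
      - Tn i (li n) x + Tn j (lj n) x @[n --> \oo] --> (0 : H)) /\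
  (* (iv) *)
  (forall i : 'I_m, x_ (ell I K i n) - x_ n @[n --> \oo] --> (0 : H)) /\
  (* (v) *)
  (x_ n - T0n n (\sum_(i < m) omega i *: Tn i (ell I K i n) (x_ n))
    @[n --> \oo] --> (0 : H)) /\
  (* (vi) *)
  ((forall y : H, weak_seq_cluster x_ y -> Fix (T0 \o wsum omega T) y) ->
    (exists2 y, Fix (T0 \o wsum omega T) y & weak_cvg x_ y) /\
    ((exists y, strong_seq_cluster x_ y) ->
      exists2 y, Fix (T0 \o wsum omega T) y & x_ n @[n --> \oo] --> y)) /\
  (* (vii) *)
  (forall (rho0 : R) (rho : 'I_m -> R),
    0 < rho0 <= 1 -> (forall i, 0 < rho i <= 1) ->
    (forall n, (K - 1 <= n)%N ->
      rho0.-lipschitz (T0n n) /\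
      forall i, i \in I n -> (rho i).-lipschitz (Tn i n)) ->
    (forall n, e0 n = 0) -> (forall i n, e i n = 0) ->
    (rho0 < 1 \/ exists i, rho i < 1) ->
    exists y, Fix (T0 \o wsum omega T) = [set y] /\ linear_cvg x_ y).
Proof.
pose l i n := ell I K i n; pose N0 := (K - 1)%N.
pose F i n := Tn i (l i n).
have eps0 : 0 < eps by case/andP: eps_bnd.
have omega0 i : 0 < omega i by case/andP: (omega_bnd i).
have lP i n : (N0 <= n)%N ->
    [/\ i \in I (l i n), (n < l i n + K)%N & (l i n <= n)%N].
  exact: ellP.
have F0_firm n : (N0 <= n)%N -> firm eps (T0n n).
  by move=> _; apply: averaged_firm eps0 (alpha0n_bnd n) (T0n_avg n).
have F_firm i n : (N0 <= n)%N -> firm eps (F i n).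
  move=> /(lP i)[il _ _].
  by apply: averaged_firm eps0 (alphan_bnd _ _ il) (Tn_avg _ _ il).
have xS n : (N0 <= n)%N -> x_ n.+1 =
    T0n n (\sum_i omega i *: (F i n (x_ (l i n)) + e i (l i n))) + e0 n.
  move=> Nn; rewrite x_S; congr (T0n n _ + _); apply: eq_bigr => i _.
  by rewrite (block_ellE I_cover t_eq).
have fixF y n : Fix (T0 \o wsum omega T) y -> (N0 <= n)%N ->
    T0n n (\sum_i omega i *: F i n y) = y.
  by move=> yfix /Fix_sub[_ /(_ _ yfix)].
(* A block activated at time [n] has no delay. *)
have hit n : (N0 <= n)%N -> exists i, l i n = n.
  move=> Nn; have /finset.set0Pn[i ii] := I_neq0 n.
  by exists i; exact: ell_eq.
pose err n := `|e0 n| + \sum_i omega i * `|e i (l i n)|.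
have err0 n : 0 <= err n.
  by rewrite addr_ge0// sumr_ge0// => i _; rewrite mulr_ge0// ltW.
have [C errC] : exists C, forall n, \sum_(N0 <= k < n) err k <= C.
  have [C0 eC0] := nneseries_bounded (fun n => normr_ge0 (e0 n)) e0_sum.
  have /choice[Ci eCi] i := nneseries_bounded
    (fun n => normr_ge0 (e i (l i n))) (e_sum i).
  exists (C0 + \sum_i omega i * Ci i) => n.
  rewrite big_split/= exchange_big/= lerD// ler_sum// => i _.
  by rewrite -mulr_sumr ler_wpM2l// ltW.
have e0_cvg : `|e0 n| @[n --> \oo] --> 0.
  have [C0 eC0] := nneseries_bounded (fun n => normr_ge0 (e0 n)) e0_sum.
  exact: bounded_sums_cvg0 eC0.
have e_cvg i : `|e i (l i n)| @[n --> \oo] --> 0.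
  have [Ci eCi] := nneseries_bounded (fun n => normr_ge0 (e i (l i n))) (e_sum i).
  exact: bounded_sums_cvg0 eCi.
(* The product is merely a positive lower bound for all the weights. *)
pose w := \prod_i omega i.
have w0 : 0 < w by apply: prodr_gt0.
have w_le i : w <= omega i.
  rewrite /w (bigD1 i)//= ler_piMr ?(ltW (omega0 _))// Num.Theory.prodr_ile1// => j _.
  by case/andP: (omega_bnd j) => /ltW-> ->.
have w1 : w <= 1.
  by apply: le_trans (w_le (Ordinal m_gt0)) _; case/andP: (omega_bnd (Ordinal m_gt0)).
have fejer y : Fix (T0 \o wsum omega T) y -> forall n B, (N0 <= n)%N ->
    (forall k, (n < k + K)%N -> (k <= n)%N -> `|x_ k - y| <= B) ->
    `|x_ n.+1 - y| <= w * `|x_ n - y| + (1 - w) * B + err n.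
  move=> yfix n B Nn xB.
  apply: (le_trans (norm_step omega0 eps0 F0_firm F_firm xS
    (fun n => fixF y n yfix) Nn)).
  rewrite lerD2r; have [i li] := hit n Nn.
  apply: (convex_window omega0 omega_sum (w_le i)) => [||j].
  - by rewrite li.
  - by apply: xB => //; lia.
  - by have [_ nl ln] := lP j n Nn; exact: xB.
have w01 : 0 < w <= 1 by rewrite w0 w1.
have dist_cvg y : Fix (T0 \o wsum omega T) y ->
    exists L : R, `|x_ n - y| @[n --> \oo] --> L.
  move=> yfix.
  exact: (window_cvg err0 K_gt0 (fun n => normr_ge0 _) w01 errC (fejer y yfix)).
have [B xB] : exists B, forall n, `|x_ n| <= B.
  have [B aB] := window_bounded err0 K_gt0 (fun n => normr_ge0 (x_ n - x)) w01 errC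
    (fejer x x_sol).
  exists (B + `|x|) => n; rewrite -{1}(subrK x (x_ n)).
  by apply: (le_trans (ler_normD _ _)); rewrite lerD2r.
have [L xL] := dist_cvg x x_sol.
have dL i : `|x_ (l i n) - x| @[n --> \oo] --> L.
  exact: (cvg_comp _ _ (cvg_ell I_cover i) xL).
have hit' n : (N0 <= n)%N -> exists i, x_ (l i n) = x_ n.
  by move=> /hit[i li]; exists i; rewrite li.
have fixx n := fixF x n x_sol.
split.
  exists B; split=> [|M BM n _ /=]; first exact: num_real.
  exact: le_trans (xB n) (ltW BM).
split.
  move=> i /=; under eq_fun do rewrite -addrA -(opprB x).
  exact: (residual_cvg omega0 omega_sum eps0 F0_firm F_firm xS
    fixx e0_cvg e_cvg xL dL i).
split.
  move=> i j; have dev := deviation_cvg omega0 omega_sum eps0 F0_firm F_firm xS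
    fixx e0_cvg e_cvg xL dL.
  (* The role of [s] is played by the weighted mean from which both deviations are measured; it
     cancels. *)
  have shift (a b p q s : H) : a - b - p + q = (a - p - s) - (b - q - s).
    by rewrite opprB addrA subrK opprD addrACA opprK addrA.
  have := cvgB (dev i) (dev j); rewrite subr0 => dev_ij /=.
  under eq_fun => n do rewrite (shift _ _ _ _
    (\sum_k omega k *: (F k n (x_ (l k n)) - F k n x))).
  exact: dev_ij.
split.
  move=> i; exact: (delayed_cvg omega0 omega_sum eps0 F0_firm F_firm xS
    fixx e0_cvg e_cvg xL dL hit' i).
split.
  exact: (outer_residual_cvg omega0 omega_sum eps0 F0_firm F_firm xS
    fixx e0_cvg e_cvg xL dL hit').
split.
  move=> clS; split; first by apply: opial dist_cvg clS; exists B.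
  (* A strong cluster point is a weak one, hence a solution; the distances to it converge, and their
     limit is 0 along the subsequence. *)
  move=> [y [k kincr xky]].
  have yfix : Fix (T0 \o wsum omega T) y.
    by apply: clS; exists k => // v; exact: cvg_dot.
  exists y => //; have [Ly xLy] := dist_cvg y yfix.
  have sub_Ly : `|x_ (k n) - y| @[n --> \oo] --> Ly.
    exact: (cvg_comp _ _ (cvgn_increasing kincr) xLy).
  have sub_0 : `|x_ (k n) - y| @[n --> \oo] --> 0.
    by apply/norm_cvg0P/subr_cvg0.
  have Ly0 : Ly = 0 by apply: (cvg_unique _ sub_Ly sub_0); exact: Rhausdorff.
  by apply/subr_cvg0/norm_cvg0P; rewrite -Ly0.
move=> rho0 rho rho0_bnd rho_bnd lip e0_0 e_0 contr.
(* A Lipschitz constant of the weighted inner operator; [rho0 * s < 1] as soon as one factor is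
   below 1, because all weights are positive. *)
pose s := \sum_i omega i * rho i.
have s0 : 0 < s.
  rewrite /s (bigD1 (Ordinal m_gt0))//= ltr_pwDl//.
    by rewrite mulr_gt0//; case/andP: (rho_bnd (Ordinal m_gt0)).
  apply: sumr_ge0 => i _; rewrite mulr_ge0 ?(ltW (omega0 _))//.
  by case/andP: (rho_bnd i) => /ltW.
have s1 : s <= 1.
  rewrite -omega_sum; apply: ler_sum => i _; rewrite ler_piMr ?(ltW (omega0 _))//.
  by case/andP: (rho_bnd i).
have [rho00 rho01] := andP rho0_bnd.
have rs : 0 < rho0 * s < 1.
  rewrite mulr_gt0//=; case: contr => [r1|[i ri]].
    by apply: le_lt_trans r1; rewrite ler_piMr// ltW.
  suff : s < 1 by apply: le_lt_trans; rewrite ler_piMl// ltW.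
  rewrite /s -omega_sum (bigD1 i)//= [ltRHS](bigD1 i)//= ltr_leD//.
    by rewrite gtr_pMr.
  by apply: ler_sum => j _; rewrite ler_piMr ?(ltW (omega0 _))//; case/andP: (rho_bnd j).
have lin y : Fix (T0 \o wsum omega T) y -> linear_cvg x_ y.
  move=> yfix.
  apply: (@window_linear _ K (K + K) _ _ K_gt0 rs (fun n => normr_ge0 (x_ n - y))).
  move=> n b Kn xb.
  have Nn : (N0 <= n)%N := leq_trans (leq_subr 1 K) (leq_trans (leq_addr K K) Kn).
  rewrite xS// e0_0 addr0 -{1}(fixF y n yfix Nn).
  have [/(_ (_, _) (conj Logic.I Logic.I)) /= h _] := lip n Nn.
  apply: (le_trans (h _ _)); rewrite -mulrA ler_wpM2l ?(ltW rho00)// /s mulr_suml -sumrB.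
  apply: (le_trans (ler_norm_sum _ _ _)); apply: ler_sum => i _.
  have [il nl ln] := lP i n Nn.
  rewrite e_0 addr0 -scalerBr normrZ gtr0_norm// -mulrA ler_wpM2l ?(ltW (omega0 _))//.
  have Nl : (N0 <= l i n)%N := window_start Kn nl.
  have [_ /(_ i il) /(_ (_, _) (conj Logic.I Logic.I)) /= hi] := lip _ Nl.
  apply: (le_trans (hi _ _)); rewrite ler_wpM2l ?xb//.
  by case/andP: (rho_bnd i) => /ltW.
have lin_cvg y : linear_cvg x_ y -> x_ n @[n --> \oo] --> y.
  move=> [c [r [c0 /andP[r0 r1] xcr]]]; apply/subr_cvg0.
  apply: (@cvg0_le _ _ _ (fun n => c * r ^+ n)); first exact: nearW.
  rewrite -(mulr0 c); apply: cvgM (cvg_cst _) _.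
  by apply: cvg_expr; rewrite gtr0_norm.
exists x; split; last exact: lin.
(* The same sequence converges to every solution, so there is only one. *)
apply/seteqP; split => [y yfix /=|_ ->//].
apply: (cvg_unique _ (lin_cvg _ (lin _ yfix)) (lin_cvg _ (lin _ x_sol))).
exact: norm_hausdorff.
Qed.
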